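(* For all integers $w\geq0$ and $p\geq p_{w}$, the graph $G_{w,p}$ contains every tree with at most $\gamma(w,p)$ edges.
   Context: For integers $w,p\geq0$ define $\alpha(w,p)=\frac{1}{1+(2/3)^{w}}\Big(\frac{2+(2/3)^{w}}{1+(2/3)^{w}}\Big)^{p-1}$, $\gamma(w,p)=\Big(\frac{2+(2/3)^{w}}{1+(2/3)^{w}}\Big)^{p}$, $\beta(w)=3(\frac{3}{2})^{w}$ and $\delta(w)=(2+(\frac{2}{3})^{w})\beta(w)$. Let $p_w$ be the smallest integer such that $\alpha(w,p_w+1)\geq\beta(w)$. For $p\geq p_w$ define $G_{w,p}$ recursively: $G_{w,p_w}$ is the complete graph $K_{\lceil\delta(w)\rceil}$, and for $p\geq p_w+1$, $G_{w,p}$ is obtained from a complete graph $K_{w+1}$ and two disjoint copies of $G_{w,p-1}$ by adding all edges between the vertices of $K_{w+1}$ and the vertices of the two copies. A graph $U$ contains a graph $H$ if some subgraph of $U$ is isomorphic to $H$. *)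

(* Defs.v *)
From HB Require Import structures.
From mathcomp Require Import all_boot all_order all_algebra.
From mathcomp Require Import zify ring lra.

Set Implicit Arguments.
Unset Strict Implicit.
Unset Printing Implicit Defensive.

Import Order.TTheory GRing.Theory Num.Theory.
Local Open Scope ring_scope.

Record sgraph := SGraph {
  svertex :> finType;
  sedge : rel svertex;
  sedge_sym : symmetric sedge;
  sedge_irrefl : irreflexive sedge
}.

Section Constructions.

Definition complete_edge (n : nat) : rel 'I_n := fun x y => x != y.

Lemma complete_edge_sym n : symmetric (@complete_edge n).
Proof. by move=> x y; rewrite /complete_edge eq_sym. Qed.

Lemma complete_edge_irrefl n : irreflexive (@complete_edge n).
Proof. by move=> x; rewrite /complete_edge eqxx. Qed.

Definition complete (n : nat) : sgraph :=
  SGraph (@complete_edge_sym n) (@complete_edge_irrefl n).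

Variables G H : sgraph.

(* [sum_edge b] is the edge relation of the disjoint union of [G] and [H],
   with all edges between the two parts added when [b] holds. *)
Definition sum_edge (b : bool) : rel (G + H)%type := fun u v =>
  match u, v with
  | inl x, inl y => sedge x y
  | inr x, inr y => sedge x y
  | _, _ => b
  end.

Lemma sum_edge_sym b : symmetric (sum_edge b).
Proof. by move=> [x|x] [y|y] //=; rewrite sedge_sym. Qed.

Lemma sum_edge_irrefl b : irreflexive (sum_edge b).
Proof. by move=> [x|x] /=; rewrite sedge_irrefl. Qed.

Definition disjoint_union : sgraph :=
  SGraph (sum_edge_sym false) (sum_edge_irrefl false).

Definition join : sgraph :=
  SGraph (sum_edge_sym true) (sum_edge_irrefl true).

End Constructions.

Definition isomorphic (G H : sgraph) : Prop :=
  exists2 f : G -> H, bijective f & forall x y, sedge (f x) (f y) = sedge x y.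

Record subgraph (U : sgraph) := Subgraph {
  sub_vertices : {set U};
  sub_edge : rel U;
  sub_edge_sym : symmetric sub_edge;
  sub_edgeP : forall x y, sub_edge x y ->
    [/\ x \in sub_vertices, y \in sub_vertices & sedge x y]
}.

Section GraphOfSubgraph.
Variables (U : sgraph) (S : subgraph U).

Definition sgraph_of_edge : rel {x : U | x \in sub_vertices S} :=
  fun x y => sub_edge S (val x) (val y).

Lemma sgraph_of_edge_sym : symmetric sgraph_of_edge.
Proof. by move=> x y; rewrite /sgraph_of_edge sub_edge_sym. Qed.

Lemma sgraph_of_edge_irrefl : irreflexive sgraph_of_edge.
Proof.
move=> x; apply/negbTE/negP => /sub_edgeP[_ _].
by rewrite sedge_irrefl.
Qed.

Definition sgraph_of_subgraph : sgraph :=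
  SGraph sgraph_of_edge_sym sgraph_of_edge_irrefl.

End GraphOfSubgraph.

Definition contains (U H : sgraph) : Prop :=
  exists S : subgraph U, isomorphic (sgraph_of_subgraph S) H.

Definition connected (T : sgraph) : Prop :=
  (0 < #|T|)%N /\ forall x y : T, connect (@sedge T) x y.

(* [ucycle] also holds of single edges traversed back and forth, hence the
   bound on the length. *)
Definition acyclic (T : sgraph) : Prop :=
  forall c : seq T, (2 < size c)%N -> ~ ucycle (@sedge T) c.

Definition is_tree (T : sgraph) : Prop := connected T /\ acyclic T.

Definition edge_set (T : sgraph) : {set {set T}} :=
  [set [set z.1; z.2] | z : T * T & sedge z.1 z.2].

Definition alpha (w p : nat) : rat :=
  (1 / (1 + (2 / 3) ^+ w)) *
  ((2 + (2 / 3) ^+ w) / (1 + (2 / 3) ^+ w)) ^ (p%:Z - 1).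

Definition gamma (w p : nat) : rat :=
  ((2 + (2 / 3) ^+ w) / (1 + (2 / 3) ^+ w)) ^+ p.

Definition beta (w : nat) : rat := 3 * (3 / 2) ^+ w.

Definition delta (w : nat) : rat := (2 + (2 / 3) ^+ w) * beta w.

Lemma alphaS w p :
  alpha w p.+1 = (1 / (1 + (2 / 3) ^+ w)) *
                 ((2 + (2 / 3) ^+ w) / (1 + (2 / 3) ^+ w)) ^+ p.
Proof.
have e : p.+1%:Z - 1 = p%:Z by lia.
by rewrite /alpha e.
Qed.

Lemma alpha_unbounded w : exists p, beta w <= alpha w p.+1.
Proof.
have q0 : 0 <= (2 / 3 : rat) ^+ w by apply: exprn_ge0.
have q1 : (2 / 3 : rat) ^+ w <= 1 by apply: exprn_ile1.
pose q := (2 / 3 : rat) ^+ w.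
have b0 : 0 <= beta w by apply: mulr_ge0 => //; apply: exprn_ge0.
have ratio n : 1 + n%:R / 2 <= ((2 + q) / (1 + q)) ^+ n.
  elim: n => [|n IHn]; first by rewrite mul0r addr0.
  have r32 : 3 / 2 <= (2 + q) / (1 + q).
    by rewrite ler_pdivlMr; rewrite -/q in q0 q1; lra.
  rewrite exprS -natr1; have n0 : 0 <= n%:R :> rat by apply: ler0n.
  nra.
have [n Hn] : exists n : nat, 4 * beta w <= n%:R.
  by exists (Num.bound (4 * beta w)); apply/ltW/archi_boundP; lra.
exists n; rewrite alphaS mul1r mulrC ler_pdivlMr -/q; last first.
  by rewrite -/q in q0; lra.
apply: le_trans (ratio n).
rewrite -/q in q0 q1; nra.
Qed.

(* No negative integer can meet the condition defining [p_min w]: the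
   only one for which it makes sense is -1, and [alpha w 0 < beta w]. *)
Definition p_min (w : nat) : nat := ex_minn (alpha_unbounded w).

Lemma alpha0_lt w : alpha w 0 < beta w.
Proof.
have q0 : 0 <= (2 / 3 : rat) ^+ w by apply: exprn_ge0.
have b1 : 1 <= (3 / 2 : rat) ^+ w by apply: exprn_ege1.
rewrite /alpha /beta sub0r exprN1 invf_div mul1r mulrA.
rewrite mulVf ?mul1r; last by rewrite gt_eqF //; lra.
apply: (@lt_le_trans _ _ 1); last by lra.
by rewrite invf_lt1; lra.
Qed.

(* Values for [p < p_min w] are junk, due to the truncated subtraction. *)
Definition G (w p : nat) : sgraph :=
  iter (p - p_min w)
    (fun H => join (complete w.+1) (disjoint_union H H))
    (complete `|Num.ceil (delta w)|%N).

Lemma G_p_min w : G w (p_min w) = complete `|Num.ceil (delta w)|%N.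
Proof. by rewrite /G subnn. Qed.

Lemma G_rec w p : (p_min w <= p)%N ->
  G w p.+1 = join (complete w.+1) (disjoint_union (G w p) (G w p)).
Proof. by move=> le_p; rewrite /G subSn. Qed.

(* Main.v *)
(* Every acyclic graph with at most gamma(w,p) + 1 vertices embeds in G(w,p), by
   induction on p.  One vertex of an acyclic graph can separate off a set whose
   size is within t/3 of a prescribed target t; correcting the error by the same
   device, w+1 vertices S suffice for an error of t/3^(w+1).  With t half the
   number of vertices, both sides have at most (1 + 3^-(w+1))/2 of the vertices,
   which is at most gamma(w,p-1)/gamma(w,p); S goes to K_(w+1) and the two sides
   to the two copies of G(w,p-1).  The base case holds because minimality of p_w
   gives gamma(w,p_w) = (2 + (2/3)^w) alpha(w,p_w) < delta(w). *)
Require Import Defs.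
From mathcomp Require Import all_boot all_order all_algebra.
From mathcomp Require Import zify ring lra.

Set Implicit Arguments.
Unset Strict Implicit.
Unset Printing Implicit Defensive.

Import Order.TTheory GRing.Theory Num.Theory.
Local Open Scope ring_scope.

(** * Separators in acyclic graphs *)

Section Separation.
Variable T : sgraph.
Implicit Types (A B C S W : {set T}) (v : T).
Local Open Scope nat_scope.

Definition separated A B := [forall x in A, forall y in B, ~~ sedge x y].

Lemma separatedP A B :
  reflect {in A & B, forall x y, ~~ sedge x y} (separated A B).
Proof.
apply: (iffP forall_inP) => [h x y xA yB|h x xA].
  by have /forall_inP := h x xA; apply.
by apply/forall_inP => y; apply: h.
Qed.

Lemma separated_sym A B : separated A B = separated B A.
Proof.
by apply/separatedP/separatedP => h x y xA yB; rewrite sedge_sym h.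
Qed.

Lemma separatedS A A' B B' :
  A' \subset A -> B' \subset B -> separated A B -> separated A' B'.
Proof.
move=> /subsetP sA /subsetP sB /separatedP h.
by apply/separatedP => x y /sA xA /sB; apply: h.
Qed.

Lemma separatedU A B C :
  separated A C -> separated B C -> separated (A :|: B) C.
Proof.
move=> /separatedP hA /separatedP hB; apply/separatedP => x y.
by rewrite inE => /orP[]; [apply: hA | apply: hB].
Qed.

(** The second hypothesis says that [A] induces a connected graph. Two neighbours of [v] in [A]
    would then be joined by a path inside [A], which [v] closes to a cycle. *)
Lemma acyclic_unique_neighbor A v : acyclic T ->
    (forall C, C \subset A -> C != set0 -> separated C (A :\: C) -> C = A) ->
    v \notin A -> A != set0 ->
  exists2 u, u \in A & {in A, forall y, sedge v y -> y = u}.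
Proof.
move=> acT connA vA /set0Pn[a aA].
have [u /andP[uA vu]|nonb] := pickP [pred u | (u \in A) && sedge v u]; last first.
  by exists a => // y yA vy; have := nonb y; rewrite /= yA vy.
exists u => // y yA vy; apply/eqP/negPn/negP => nyu.
pose e : rel T := [rel x z | [&& x \in A, z \in A & sedge x z]].
pose C := [set z in A | connect e u z].
have CA : C = A.
  apply: connA.
  - by apply/subsetP => z; rewrite inE => /andP[].
  - by apply/set0Pn; exists u; rewrite inE uA connect0.
  apply/separatedP => x z; rewrite !inE => /andP[xA ux] /andP[/nandP h zA].
  apply/negP => xz; case: h; rewrite ?zA // => /negP; apply.
  by apply: connect_trans ux (connect1 _); rewrite /e /= xA zA.
have : y \in C by rewrite CA.
rewrite inE yA => /connectP[p0 /shortenP[p pth unq _] eqy].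
have pA z : z \in u :: p -> z \in A.
  rewrite inE => /predU1P[->//|zp]; move: pth zp; clear -uA.
  elim: p u uA => [|b p IH] u uA; first by rewrite in_nil.
  rewrite /= => /andP[/and3P[_ bA _] pth].
  by rewrite inE => /predU1P[->//|zp]; apply: (IH b).
apply: (acT (v :: u :: p)).
  by case: (p) eqy nyu => //= ->; rewrite eqxx.
rewrite /ucycle; apply/andP; split; last first.
  by rewrite cons_uniq unq andbT; apply: contra vA => /pA.
rewrite /= vu rcons_path /= -eqy (sedge_sym y) vy andbT.
by apply: sub_path pth => x z /and3P[].
Qed.

(* Take [A] of minimal size at least [t] among the sets that some vertex [v]
   separates from the rest.  If [A] is large but disconnected, its larger part
   works; if it is connected, then [v] has at most one neighbour [u] in [A], and
   [u] separates [A :\ u], contradicting minimality. *)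
Lemma acyclic_third_separator W t : acyclic T -> t < #|W| ->
  exists v A, [/\ v \in W, A \subset W :\ v, separated A (W :\ v :\: A),
                  2 * t <= 3 * #|A| & 3 * #|A| <= 4 * t].
Proof.
move=> acT ltW.
pose P (z : T * {set T}) := [&& z.1 \in W, z.2 \subset W :\ z.1,
  separated z.2 (W :\ z.1 :\: z.2) & t <= #|z.2|].
have /card_gt0P[a aW] : 0 < #|W| by lia.
have Pa : P (a, W :\ a).
  apply/and4P; split => //=; last by have := cardsD1 a W; rewrite aW; lia.
  by apply/separatedP => x y _; rewrite setDv inE.
case: (arg_minnP (fun z : T * {set T} => #|z.2|) Pa) => -[v A] /and4P[/= vW sA sepA leA] minA.
have [le|gt] := leqP (3 * #|A|) (4 * t).
  by exists v, A; split => //; lia.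
have vA : v \notin A.
  by apply/negP => /(subsetP sA); rewrite !inE eqxx.
have [C /and4P[sC C0 sepC CA]|nosplit] := pickP [pred C : {set T} |
  [&& C \subset A, C != set0, separated C (A :\: C) & C != A]].
  (* Either side of a split of [A] is still cut off by [v], so minimality makes it smaller than [t].
     As [3 * #|A| > 4 * t], the larger side exceeds two thirds of [t]. *)
  have splitP C' : C' \subset A -> separated C' (A :\: C') ->
      [/\ C' \subset W :\ v, separated C' (W :\ v :\: C')
        & #|C'| < #|A| -> #|C'| < t].
    move=> sC' sepC'.
    have sW : C' \subset W :\ v by apply: subset_trans sA.
    have sepW : separated C' (W :\ v :\: C').
      apply/separatedP => x y xC; rewrite inE => /andP[yC yW].
      have [yA|yA] := boolP (y \in A).
        by apply: (separatedP _ _ sepC') => //; rewrite inE yC.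
      apply: (separatedP _ _ sepA); first exact: (subsetP sC').
      by rewrite inE yA.
    split=> // lt; rewrite ltnNge; apply/negP => le.
    have /minA /= : P (v, C') by apply/and4P.
    by rewrite leqNgt lt.
  have [sW sepW ltC] := splitP C sC sepC.
  have [sW' sepW' ltD] : [/\ A :\: C \subset W :\ v,
      separated (A :\: C) (W :\ v :\: (A :\: C)) & #|A :\: C| < #|A| -> #|A :\: C| < t].
    apply: splitP; first exact: subsetDl.
    by rewrite setDDr setDv set0U (setIidPr sC) separated_sym.
  have := cardsID C A; rewrite (setIidPr sC).
  have : 0 < #|C| by rewrite card_gt0.
  have : #|C| < #|A| by apply: proper_card; rewrite properEneq CA.
  move=> h1 h2 h3.
  have ltDA : #|A :\: C| < #|A| by rewrite -h3 -[X in X < _]add0n ltn_add2r.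
  have := ltC h1; have := ltD ltDA; clear ltC ltD minA.
  case: (leqP #|C| #|A :\: C|) => h4 h5 h6.
    by exists v, (A :\: C); split => //; move: gt h3 h4 h5 h6; clear; lia.
  by exists v, C; split => //; move: gt h3 h4 h5 h6; clear; lia.
have A0 : A != set0 by rewrite -card_gt0; lia.
have [C sC C0 sepC|//|u uA uniqu] := acyclic_unique_neighbor (v := v) acT _ _ A0.
  by have := nosplit C; rewrite /= sC C0 sepC /= => /negbFE/eqP.
have uW : u \in W by have := subsetP sA u uA; rewrite !inE => /andP[].
have cA := cardsD1 u A; rewrite uA in cA.
have /minA /= : P (u, A :\ u).
  apply/and4P; split => //=; last by lia.
    by apply: setSD; apply: subset_trans sA (subsetDl _ _).
  (* Removing [u] instead of [v] puts [v] on the far side, and [v] has no neighbour in [A] other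
     than [u]. *)
  apply/separatedP => x y; rewrite !inE => /andP[xu xA] /and3P[h yu yW].
  have yA : y \notin A by move: h; rewrite yu.
  have [->|yv] := eqVneq y v.
    by rewrite sedge_sym; apply: contra xu => /(uniqu x xA)/eqP.
  by apply: (separatedP _ _ sepA) => //; rewrite !inE yA yv.
lia.
Qed.

(* The upper bound ignores [S] and the lower bound counts it, so that the
   statement is stable under complementing [A] in [W :\: S]. *)
Lemma acyclic_approx_separator k W t : acyclic T -> 0 < t -> 2 * t <= #|W| ->
  exists S A, [/\ S \subset W, A \subset W :\: S,
    separated A (W :\: S :\: A), #|S| <= k.+1 &
    3 ^ k.+1 * #|A| <= 3 ^ k.+1 * t + t /\
    3 ^ k.+1 * t.+1 <= 3 ^ k.+1 * (#|A| + #|S|) + t].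
Proof.
move=> acT; elim: k W t => [|k IH] W t t0 leW.
  have [|v [A [vW sA sepA lo hi]]] := @acyclic_third_separator W t acT; first lia.
  by exists [set v], A; rewrite sub1set cards1; split=> //; lia.
have [|v [A [vW sA sepA lo hi]]] := @acyclic_third_separator W t acT; first lia.
have AW : A \subset W := subset_trans sA (subsetDl _ _).
have cW : #|W| = #|A| + #|W :\ v :\: A| + 1.
  have := cardsD1 v W; rewrite vW => ->.
  by have := cardsID A (W :\ v); rewrite (setIidPr sA); lia.
have vA : v \notin A by apply/negP => /(subsetP sA); rewrite !inE eqxx.
have [ltA|gtA|eqA] := ltngtP #|A| t.
(* The deficit [t - #|A|], at most t/3, is cut out of the remaining vertices and added to [A]. The
   relative error 3^-(k+1) of this correction is thus 3^-(k+2) relative to [t]. *)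
- have [||S [B [sS sB sepB cS [h1 h2]]]] := IH (W :\ v :\: A) (t - #|A|); try lia.
  have vS : v \notin S.
    by apply/negP => /(subsetP sS); rewrite !inE eqxx andbF.
  have dAB : [disjoint A & B].
    rewrite disjoint_sym; apply: disjointWl sB _; rewrite disjoint_subset.
    by apply/subsetP => x; rewrite !inE => /and3P[].
  exists (v |: S), (A :|: B); split.
  + rewrite subUset sub1set vW; apply: subset_trans sS _.
    by rewrite setDDl subsetDl.
  + rewrite -setDDl subUset; apply/andP; split.
      rewrite subsetD sA disjoint_sym.
      apply: disjointWl sS _; rewrite disjoint_subset.
      by apply/subsetP => x; rewrite !inE => /and3P[].
    by apply: subset_trans sB _; apply: setSD; apply: subsetDl.
  + apply: separatedU.
      apply: separatedS sepA => //; apply/subsetP => x; rewrite !inE.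
      by rewrite !negb_or -!andbA => /and5P[-> _ -> _ ->].
    apply: separatedS sepB => //; apply/subsetP => x; rewrite !inE.
    by rewrite !negb_or -!andbA => /and5P[-> -> -> -> ->].
  + by rewrite cardsU1 vS.
  rewrite cardsU1 vS (cardsU A B) (disjoint_setI0 dAB) cards0 subn0.
  rewrite (expnS 3 k.+1); set M := 3 ^ k.+1 in h1 h2 *.
  have : M * (t - #|A|) + M * #|A| = M * t by rewrite -mulnDr subnK 1?ltnW.
  by move: h1 h2 lo hi; clear; split; lia.
(* The excess, again at most t/3, is cut out of [A] as [B] and dropped. Complementing in [A] swaps
   the two bounds of the induction hypothesis. *)
- have [||S [B [sS sB sepB cS [h1 h2]]]] := IH A (#|A| - t); try lia.
  have vS : v \notin S by apply: contra vA; apply: subsetP.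
  exists (v |: S), (A :\: S :\: B); split.
  + by rewrite subUset sub1set vW (subset_trans sS).
  + rewrite -setDDl; apply: subset_trans (subsetDl _ _) _.
    exact: setSD.
  + rewrite separated_sym; apply/separatedP => x y.
    rewrite !inE => h /and3P[yB yS yA].
    have [xA|xA] := boolP (x \in A).
      have xB : x \in B by move: h; rewrite xA; case: (x \in S) (x \in B) => [] [];
        rewrite ?orbT ?andbF.
      by apply: (separatedP _ _ sepB); rewrite ?inE ?yB ?yS.
    rewrite sedge_sym; apply: (separatedP _ _ sepA) => //.
    by move: h; rewrite negb_or !inE xA => /andP[_ /andP[/andP[-> _] ->]].
  + by rewrite cardsU1 vS.
  have c1 := cardsID S A; rewrite (setIidPr sS) in c1.
  have c2 := cardsID B (A :\: S); rewrite (setIidPr sB) in c2.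
  rewrite cardsU1 vS (expnS 3 k.+1); set M := 3 ^ k.+1 in h1 h2 *.
  have : M * (#|A| - t) + M * t = M * #|A| by rewrite -mulnDr subnK 1?ltnW.
  have : M * #|A| = M * #|S| + M * #|B| + M * #|A :\: S :\: B|.
    by rewrite -!mulnDr -addnA c2 c1.
  by move: h1 h2 lo hi; clear; split; lia.
exists [set v], A; rewrite sub1set cards1; split => //.
by rewrite eqA; split; lia.
Qed.

Lemma acyclic_bisection k W : acyclic T ->
  exists S A B, [/\ W = S :|: (A :|: B), separated A B, #|S| <= k.+1,
    2 * 3 ^ k.+1 * #|A| <= (3 ^ k.+1).+1 * #|W| &
    2 * 3 ^ k.+1 * #|B| <= (3 ^ k.+1).+1 * #|W| ].
Proof.
move=> acT; have [leW|gtW] := leqP #|W| 1.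
  (* The target [#|W| %/ 2] would be 0 here, which the approximation excludes. *)
  exists W, set0, set0; rewrite !setU0 cards0 muln0; split => //; last lia.
  by apply/separatedP => x y; rewrite inE.
have [||S [A [sS sA sepA cS [h1 h2]]]] :=
  @acyclic_approx_separator k W (#|W| %/ 2) acT; try lia.
exists S, A, (W :\: S :\: A).
have c1 := cardsID S W; rewrite (setIidPr sS) in c1.
have c2 := cardsID A (W :\: S); rewrite (setIidPr sA) in c2.
split => //.
- rewrite -[LHS](setID W S) (setIidPr sS); congr (_ :|: _).
  by rewrite -[LHS](setID _ A) (setIidPr sA).
- by move: h1; clear; set M := 3 ^ k.+1 => h1; nia.
move: h1 h2 c1 c2; clear; set M := 3 ^ k.+1 => h1 h2 c1 c2.
have : M * #|W| = M * (#|A| + #|S|) + M * #|W :\: S :\: A|.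
  by rewrite -mulnDr -c1 -c2 (addnC _ #|S|) addnA.
(* When [#|W|] is odd, the leftover vertex is absorbed by the successor in the lower bound [h2]. *)
have : M * #|W| <= M * (2 * (#|W| %/ 2)).+1 by rewrite leq_mul2l; lia.
nia.
Qed.

End Separation.

(** * Embeddings of vertex subsets *)

(** Subsets of a fixed [T] avoid passing to induced subgraphs in the induction. The map is total, so
    [U] must be nonempty as soon as [T] is, even for empty [W]. *)
Definition embeds (T U : sgraph) (W : {set T}) := exists f : T -> U,
  {in W &, injective f} /\ {in W &, forall x y, sedge x y -> sedge (f x) (f y)}.

Lemma embeds_complete (T : sgraph) (W : {set T}) n :
  (0 < n)%N -> (#|W| <= n)%N -> embeds (complete n) W.
Proof.
case: n => // n _ leW.
have idx x : x \in W -> (index x (enum W) < n.+1)%N.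
  by move=> xW; apply: leq_trans leW; rewrite cardE index_mem mem_enum.
have inj : {in W &, injective (fun x => inord (index x (enum W)) : 'I_n.+1)}.
  move=> x y xW yW /(congr1 val) /=; rewrite !inordK ?idx //.
  by move/(congr1 (nth x (enum W))); rewrite !nth_index ?mem_enum.
exists (fun x => inord (index x (enum W)) : 'I_n.+1); split => // x y xW yW xy.
rewrite /= /complete_edge; apply/eqP => /(inj _ _ xW yW) eqxy.
by move: xy; rewrite eqxy sedge_irrefl.
Qed.

(** The sets may overlap: [S] takes precedence over [A], and [A] over [B]. The join supplies all
    edges leaving the image of [S]; separation means that none is required between the two
    copies. *)
Lemma embeds_join (T U1 U2 U3 : sgraph) (S A B : {set T}) :
    separated A B -> embeds U1 S -> embeds U2 A -> embeds U3 B ->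
  embeds (join U1 (disjoint_union U2 U3)) (S :|: (A :|: B)).
Proof.
move=> sepAB [f [finj fhom]] [g [ginj ghom]] [h [hinj hhom]].
exists (fun x => if x \in S then inl (f x) else
  inr (if x \in A then inl (g x) else inr (h x))); split => x y; rewrite !inE.
  case: (x \in S) (y \in S) (@finj x y) => [] [] //= {}finj.
    by move=> _ _ [] /finj; apply.
  case: (x \in A) (y \in A) (@ginj x y) => [] [] //= {}ginj.
    by move=> _ _ [] /ginj; apply.
  by move=> xB yB [] /hinj; apply.
case: (x \in S) (y \in S) (@fhom x y) => [] [] //= {}fhom.
have := separatedP _ _ sepAB x y; have := separatedP _ _ sepAB y x.
rewrite (sedge_sym y x).
case: (x \in A) (y \in A) (@ghom x y) => [] [] //= {}ghom.
- by move=> _ h' _ yB; rewrite (negbTE (h' isT yB)).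
- by move=> h' _ xB _; rewrite (negbTE (h' isT xB)).
by move=> _ _ xB yB; apply: hhom.
Qed.

Lemma embeds_contains (T U : sgraph) : embeds U [set: T] -> contains U T.
Proof.
case=> f [finj fhom].
have {}finj : injective f by move=> x y; apply: finj; rewrite inE.
have {}fhom x y : sedge x y -> sedge (f x) (f y).
  by apply: fhom; rewrite inE.
(* [U] may have further edges between image vertices, so only the images of edges of [T] are
   kept. *)
pose E : rel U := fun x y =>
  [exists z : T * T, [&& sedge z.1 z.2, f z.1 == x & f z.2 == y]].
have Ef x y : E (f x) (f y) = sedge x y.
  apply/existsP/idP => [[[a b] /= /and3P[ab /eqP/finj <- /eqP/finj <-]]//|xy].
  by exists (x, y); rewrite /= xy !eqxx.
have Esym : symmetric E.
  have Eimp x y : E x y -> E y x.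
    case/existsP=> -[a b] /= /and3P[ab fa fb]; apply/existsP.
    by exists (b, a); rewrite /= sedge_sym ab fa fb.
  by move=> x y; apply/idP/idP; apply: Eimp.
have EP x y : E x y ->
    [/\ x \in [set z in codom f], y \in [set z in codom f] & sedge x y].
  case/existsP=> -[a b] /= /and3P[ab /eqP <- /eqP <-].
  by rewrite !inE !codom_f fhom.
exists (Subgraph Esym EP).
have mem (x : sgraph_of_subgraph (Subgraph Esym EP)) : val x \in codom f.
  by case: x => x /=; rewrite inE.
have fmem x : f x \in [set z in codom f] by rewrite inE codom_f.
exists (fun x => iinv (mem x)).
  exists (fun x => Sub (f x) (fmem x)) => x.
    by apply: val_inj; rewrite SubK f_iinv.
  by apply: finj; rewrite f_iinv SubK.
by move=> x y; rewrite -Ef !f_iinv.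
Qed.

(** * Vertices against edges in a connected graph *)

(** With [d] the distance from a root [r], each other vertex has a parent closer to [r]. The edges
    to parents are distinct: two vertices sharing one would each be closer to [r] than the other. *)
Lemma connected_card (T : sgraph) : connected T -> (#|T| <= #|edge_set T|.+1)%N.
Proof.
case=> /card_gt0P[r _] conT.
have reach x : exists n, [exists p : n.-tuple T, path (@sedge T) r p && (last r p == x)].
  have /connectP[p pth ->] := conT r x.
  by exists (size p); apply/existsP; exists (in_tuple p); rewrite pth eqxx.
pose d x := ex_minn (reach x).
have closer x : x != r -> exists y, sedge x y && (d y < d x)%N.
  move=> xr; rewrite {2}/d; case: ex_minnP => n /existsP[[p /= /eqP sp]].
  case/lastP: p sp => [|p z] sp /andP[pth /eqP lst] _.
    by rewrite -lst eqxx in xr.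
  move: pth lst; rewrite rcons_path last_rcons => /andP[pth lz] zx.
  exists (last r p); rewrite -zx sedge_sym lz -sp size_rcons ltnS /d.
  case: ex_minnP => m _; apply; apply/existsP; exists (in_tuple p).
  by rewrite pth eqxx.
pose parent x := odflt r [pick y | sedge x y && (d y < d x)%N].
have parentP x : x != r -> sedge x (parent x) && (d (parent x) < d x)%N.
  move=> /closer[y hy]; rewrite /parent; case: pickP => //= h.
  by rewrite h in hy.
pose F x := [set x; parent x].
have Finj : {in [set~ r] &, injective F}.
  move=> x y; rewrite !inE => /parentP/andP[_ dx] /parentP/andP[_ dy] eqF.
  have : x \in F y by rewrite -eqF !inE eqxx.
  have : y \in F x by rewrite eqF !inE eqxx.
  rewrite !inE => /predU1P[//|/eqP yx] /predU1P[//|/eqP xy].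
  by move: dx dy; rewrite -yx -xy; lia.
have : (#|F @: [set~ r]| <= #|edge_set T|)%N.
  apply/subset_leq_card/subsetP => _ /imsetP[x xr ->].
  apply/imsetP; exists (x, parent x) => //.
  by move: xr; rewrite !inE => /parentP/andP[].
by rewrite (card_in_imset Finj) cardsC1; lia.
Qed.

(** * Numerical estimates *)

Lemma two_thirds_exp_itv w : 0 < (2 / 3 : rat) ^+ w <= 1.
Proof.
have [x0 x1] : 0 < 2 / 3 :> rat /\ 2 / 3 <= 1 :> rat by split; lra.
by rewrite (exprn_gt0 _ x0) (exprn_ile1 _ (ltW x0) x1).
Qed.

Lemma delta_gt0 w : 0 < delta w.
Proof.
have b0 : 0 < beta w by apply: mulr_gt0; [lra|apply: exprn_gt0; lra].
rewrite mulr_gt0 //; case/andP: (two_thirds_exp_itv w).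
by move: (_ ^+ w) => q; lra.
Qed.

Lemma gamma_ge0 w p : 0 <= gamma w p.
Proof.
rewrite /gamma; case/andP: (two_thirds_exp_itv w); move: (_ ^+ w) => q q0 _.
by rewrite exprn_ge0 // divr_ge0; lra.
Qed.

Lemma gamma_alpha w p : gamma w p = (2 + (2 / 3) ^+ w) * alpha w p.
Proof.
case/andP: (two_thirds_exp_itv w) => q0 _.
case: p => [|p]; [rewrite /gamma /alpha sub0r exprN1 expr0|rewrite alphaS /gamma exprS].
  move: (_ ^+ w) q0 => q q0; field.
  by apply/andP; split; rewrite gt_eqF //; lra.
move: (_ ^+ w) q0 => q q0; move: (_ ^+ p) => x; field.
by rewrite gt_eqF //; lra.
Qed.

Lemma gamma_p_min w : gamma w (p_min w) < delta w.
Proof.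
rewrite gamma_alpha /delta ltr_pM2l.
  (* If [p_min w] is 0, minimality gives nothing and [alpha0_lt] takes over. *)
  rewrite /p_min; case: ex_minnP => -[|n] _ minn; first exact: alpha0_lt.
  by rewrite ltNge; apply/negP => /minn; rewrite ltnn.
by case/andP: (two_thirds_exp_itv w); move: (_ ^+ w) => q; lra.
Qed.

(** [n] and [a] count vertices, hence the added 1. With M = 3^(w+1), the factor (M+1)/(2M) is at
    most [gamma w p / gamma w p.+1], and at most 1, so the added 1 survives too. *)
Lemma bisection_gamma w p n a : n%:R <= gamma w p.+1 + 1 ->
  (2 * 3 ^ w.+1 * a <= (3 ^ w.+1).+1 * n)%N -> a%:R <= gamma w p + 1.
Proof.
rewrite -(ler_nat rat) !natrM -(natr1 (3 ^ _)%N) !natrX.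
have Mq : 3 <= (3 : rat) ^+ w.+1 * (2 / 3) ^+ w.
  rewrite exprS -mulrA -exprMn (_ : 3 * (2 / 3) = 2); last lra.
  have : 1 <= (2 : rat) ^+ w by apply: exprn_ege1; lra.
  lra.
have M1 : 1 <= (3 : rat) ^+ w.+1 by apply: exprn_ege1; lra.
have g0 := gamma_ge0 w p.
have : gamma w p.+1 = (2 + (2 / 3) ^+ w) / (1 + (2 / 3) ^+ w) * gamma w p.
  by rewrite /gamma exprS.
case/andP: (two_thirds_exp_itv w).
move: (_ ^+ w.+1) (_ ^+ w) (gamma w p) (gamma w p.+1) Mq M1 g0.
move=> M q g g' Mq M1 g0 q0 q1 -> hn ha.
(* With denominators cleared this reads 2 + q <= M q, and M q = 3 * 2^w >= 3 while q <= 1. *)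
have Mr : (M + 1) * ((2 + q) / (1 + q)) <= 2 * M.
  by rewrite mulrA ler_pdivrMr; lra.
have hM : (M + 1) * n%:R <= (M + 1) * ((2 + q) / (1 + q) * g + 1).
  by rewrite ler_wpM2l //; lra.
have := ler_wpM2r g0 Mr; rewrite -(mulrA (M + 1)) => hMg.
have M0 : 0 < 2 * M by lra.
by rewrite -(ler_pM2l M0); lra.
Qed.

(** * The induction on [p] *)

Lemma acyclic_embeds_G_p_min w (T : sgraph) (W : {set T}) :
  #|W|%:R <= gamma w (p_min w) + 1 -> embeds (G w (p_min w)) W.
Proof.
move=> leW; rewrite G_p_min; have ceil_gt0 : 0 < Num.ceil (delta w).
  by rewrite ceil_gt0 delta_gt0.
apply: embeds_complete; first by lia.
(* Strictness in [gamma_p_min] pays for the extra vertex: an integer [#|W| - 1] strictly below the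
   ceiling leaves room for [#|W|] vertices. *)
have ltW : (#|W|%:Z - 1)%:~R < (Num.ceil (delta w))%:~R :> rat.
  apply: lt_le_trans (ceil_ge _); apply: le_lt_trans (gamma_p_min w).
  by rewrite rmorphB /= lerBlDr.
by move: ltW; rewrite ltr_int; lia.
Qed.

(** Only acyclicity is assumed because the two sides of a bisection of a tree may be
    disconnected. *)
Lemma acyclic_embeds_G w p (T : sgraph) (W : {set T}) : (p_min w <= p)%N ->
  acyclic T -> #|W|%:R <= gamma w p + 1 -> embeds (G w p) W.
Proof.
move=> + acT; elim: p W => [|p IH] W; rewrite leq_eqVlt => /orP[/eqP <-|] //.
- by move=> leW; apply: acyclic_embeds_G_p_min.
- by move=> leW; apply: acyclic_embeds_G_p_min.
rewrite ltnS => lep leW; rewrite G_rec //.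
have [S [A [B [eqW sepAB cS leA leB]]]] := acyclic_bisection w W acT.
rewrite {1}eqW; apply: embeds_join sepAB _ _ _; first exact: embeds_complete.
  by apply: IH => //; apply: bisection_gamma leW leA.
by apply: IH => //; apply: bisection_gamma leW leB.
Qed.

Theorem theorem3p8 (w p : nat) (hp : (p_min w <= p)%N)
    (T : sgraph) (hT : is_tree T)
    (hE : (#|edge_set T|)%:R <= gamma w p) :
  contains (G w p) T.
Proof.
case: hT => conT acT; apply/embeds_contains/acyclic_embeds_G => //.
rewrite cardsT; apply: le_trans (_ : #|edge_set T|.+1%:R <= _).
  by rewrite ler_nat connected_card.
by rewrite -natr1 lerD2r.
Qed.
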